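(* Suppose $\mathcal{S}_{ij}\subseteq 2^{\mathcal{Q}_{ij}}$ is down-closed for every $(i,j)\in E(\mathcal{T})$. Then $\mathcal{A}(\mathcal{S},\mathcal{T})\subseteq\mathcal{B}(\mathcal{S},\mathcal{T})$. Therefore, when $\mathcal{S}_{ij}=2^{\mathcal{Q}_{ij}}$ for all $(i,j)\in E(\mathcal{T})$, strong duality holds between the tree-structured problem and its M-Lagrangian relaxation, i.e. $\mathrm{DUAL}^M=\mathrm{OPT}$.
   Context: $\mathbf{conv}$ denotes convex hull; $\min$ is read as infimum in the extended reals. A family of sets is down-closed if it contains every subset of each of its members. General MIP: $\min\{c^\top x: Ax\le b,\ x \text{ mixed-binary}\}$ with rational $c,b,A$, where ''mixed-binary'' means that a prescribed subset of the variables is required to be in $\{0,1\}$ and the others are continuous. Its intersection graph $\mathcal{G}$ has one vertex per variable, two vertices being adjacent iff the variables appear in a common constraint of $Ax\le b$. A tree decomposition of $\mathcal{G}$ is a pair $(\mathcal{T},\mathcal{Q})$ with $\mathcal{T}$ a tree and $\mathcal{Q}=\{\mathcal{Q}_t\subseteq V(\mathcal{G}):t\in V(\mathcal{T})\}$ such that: for each $v\in V(\mathcal{G})$ the set $\{t:v\in\mathcal{Q}_t\}$ forms a subtree of $\mathcal{T}$; each edge $(u,v)$ of $\mathcal{G}$ has $u,v\in\mathcal{Q}_t$ for some $t$; and $\bigcup_t\mathcal{Q}_t=V(\mathcal{G})$. Put $\mathcal{Q}_{ij}=\mathcal{Q}_i\cap\mathcal{Q}_j$. Tree-structured reformulation: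 each block $i\in V(\mathcal{T})$ has local copies $x^{(i)}=(x^{(i)}_v)_{v\in\mathcal{Q}_i}$ of the variables in $\mathcal{Q}_i$ (with the same binary restrictions); each constraint of $Ax\le b$ is assigned to some block whose bag contains all its variables, and $\mathcal{X}^{(i)}$ is the set of $x^{(i)}$ satisfying the constraints assigned to block $i$ and the binary restrictions. The objective is split as $\sum_i\langle c^{(i)},x^{(i)}\rangle$ with $\sum_{i:v\in\mathcal{Q}_i}c^{(i)}_v=c_v$. The problem is $$\mathrm{OPT}=\min\Big\{\sum_{i\in V(\mathcal{T})}\langle c^{(i)},x^{(i)}\rangle:\ x^{(i)}\in\mathcal{X}^{(i)}\ \forall i\in V(\mathcal{T}),\ x^{(i)}_v=x^{(j)}_v\ \forall (i,j)\in E(\mathcal{T}),\,v\in\mathcal{Q}_{ij}\Big\}.$$ Standing assumption: coupling constraints involve only binary variables (every $v\in\mathcal{Q}_{ij}$, $(i,j)\in E(\mathcal{T})$, is a binary variable). M-Lagrangian relaxation: let $\mathcal{X}^{(i)}_M=\{(x^{(i)},w^{(i)}):x^{(i)}\in\mathcal{X}^{(i)},\ w^{(i)}_S=\prod_{v\in S}x^{(i)}_v\ \forall S\subseteq\mathcal{Q}_i\}$ (empty product $=1$). For $\mathcal{S}=\{\mathcal{S}_{ij}\}_{(i,j)\in E(\mathcal{T})}$ with $\mathcal{S}_{ij}\subseteq 2^{\mathcal{Q}_{ij}}$, let (with $x=(x^{(i)})_{i}$) $$\mathcal{A}(\mathcal{S},\mathcal{T})=\{x:\exists w,\ (x^{(i)},w^{(i)})\in\mathbf{conv}\{\mathcal{X}^{(i)}_M\}\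 \forall i\in V(\mathcal{T}),\ w^{(i)}_S=w^{(j)}_S\ \forall (i,j)\in E(\mathcal{T}),\,S\in\mathcal{S}_{ij}\},$$ $$\mathcal{B}(\mathcal{S},\mathcal{T})=\bigcap_{\mathcal{U}\unlhd\mathcal{S}}\mathbf{conv}\{x:x^{(i)}\in\mathcal{X}^{(i)}\ \forall i\in V(\mathcal{T}),\ x^{(i)}_v=x^{(j)}_v\ \forall (i,j)\in E(\mathcal{T}),\,v\in\mathcal{U}_{ij}\},$$ where $\mathcal{U}\unlhd\mathcal{S}$ means $\mathcal{U}=\{\mathcal{U}_{ij}\}_{(i,j)\in E(\mathcal{T})}$ with $\mathcal{U}_{ij}\in\mathcal{S}_{ij}$ for all $(i,j)\in E(\mathcal{T})$. The value of the M-Lagrangian dual (dualizing $w^{(i)}_S=w^{(j)}_S$, $(i,j)\in E(\mathcal{T})$, $S\in\mathcal{S}_{ij}$) is given by its primal characterization $\mathrm{DUAL}^M=\min\{\sum_i\langle c^{(i)},x^{(i)}\rangle:x\in\mathcal{A}(\mathcal{S},\mathcal{T})\}$. *)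

(* Defs.v *)
From HB Require Import structures.
From mathcomp Require Import all_boot all_order all_algebra.
From mathcomp Require Import all_classical all_reals all_analysis.

Set Implicit Arguments.
Unset Strict Implicit.
Unset Printing Implicit Defensive.

Import Order.TTheory GRing.Theory Num.Theory.

Local Open Scope classical_set_scope.
Local Open Scope ring_scope.

Section Trees.
Variables (I : finType) (E : rel I).

Definition induced (W : {set I}) : rel I :=
  [rel i j | [&& E i j, i \in W & j \in W]].

(* A cycle of a simple graph is a closed walk through at least three distinct
   vertices: a duplicate-free [:: i; j] is the walk back and forth on an edge. *)
Definition induces_tree (W : {set I}) : Prop :=
  [/\ W != finset.set0,
      {in W &, forall i j, connect (induced W) i j}
    & forall s : seq I, ucycle (induced W) s -> (size s <= 2)%N].

Definition is_tree : Prop :=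
  [/\ symmetric E, irreflexive E & induces_tree [set: I]].

End Trees.

Definition intersection_graph m n (A : 'M[rat]_(m, n)) : rel 'I_n :=
  [rel u v | (u != v) && [exists r, (A r u != 0) && (A r v != 0)]].

Section TreeDecomposition.
Variables (V I : finType) (G : rel V) (E : rel I) (Q : I -> {set V}).

Definition tree_decomposition : Prop :=
  [/\ is_tree E,
      forall v, induces_tree E [set t | v \in Q t],
      forall u v, G u v -> exists t, (u \in Q t) && (v \in Q t)
    & \bigcup_t Q t = [set: V]]%SET.

End TreeDecomposition.

Definition down_closed (V : finType) (F : {set {set V}}) : Prop :=
  forall X Y : {set V}, X \in F -> Y \subset X -> Y \in F.

Definition conv_hull (R : realType) (M : lmodType R) (X : set M) : set M :=
  smallest (@convex_set R M) X.

Section TreeStructuredProblem.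
Variables (R : realType) (m n : nat) (I : finType).
Variables (A : 'M[rat]_(m, n)) (b : 'cV[rat]_m) (binary : {set 'I_n}).
Variables (E : rel I) (Q : I -> {set 'I_n}) (block_of : 'I_m -> I).

Definition assignment : Prop :=
  forall r v, A r v != 0 -> v \in Q (block_of r).

Definition bag (i : I) : finType := {v : 'I_n | v \in Q i}.
Definition subbag (i : I) : finType := {T : {set 'I_n} | T \subset Q i}.

Definition local_point (i : I) := {ffun bag i -> R}.
Definition moments (i : I) := {ffun subbag i -> R}.

(* The tuple (x^(i))_i of local points, flattened into a single vector so that
   it lives in an lmodType. *)
Definition joint_point := {ffun {i : I & bag i} -> R}.
Definition block (x : joint_point) (i : I) : local_point i :=
  [ffun v => x (Tagged bag v)].

Definition local_feasible (i : I) : set (local_point i) :=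
  [set y | (forall r, block_of r = i ->
              \sum_(v : bag i) ratr (A r (val v)) * y v <= ratr (b r 0)) /\
           (forall v : bag i, val v \in binary -> y v = 0 \/ y v = 1)].

Definition moment_feasible (i : I) : set (local_point i * moments i)%type :=
  [set yw : local_point i * moments i |
     local_feasible yw.1 /\
     forall T : subbag i, yw.2 T = \prod_(v : bag i | val v \in val T) yw.1 v].

Definition agree_on (x : joint_point) (i j : I) (T : {set 'I_n}) : Prop :=
  forall v (vi : v \in Q i) (vj : v \in Q j), v \in T ->
    block x i (Sub v vi) = block x j (Sub v vj).

(* Families indexed by the edges (i, j) of the tree are functions evaluated at
   the unordered pair [set i; j]; their values elsewhere are never used. *)
Definition coupled (U : {set I} -> {set 'I_n}) : set joint_point :=
  [set x | (forall i, local_feasible (block x i)) /\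
           (forall i j, E i j -> agree_on x i j (U [set i; j]%SET))].

Definition edge_choice (U : {set I} -> {set 'I_n})
    (S : {set I} -> {set {set 'I_n}}) : Prop :=
  forall i j, E i j -> U [set i; j]%SET \in S [set i; j]%SET.

Definition relaxA (S : {set I} -> {set {set 'I_n}}) : set joint_point :=
  [set x | exists w : forall i, moments i,
     (forall i, conv_hull (@moment_feasible i) (block x i, w i)) /\
     (forall i j, E i j ->
        forall (T : {set 'I_n}) (Ti : T \subset Q i) (Tj : T \subset Q j),
          T \in S [set i; j]%SET -> w i (Sub T Ti) = w j (Sub T Tj))].

Definition relaxB (S : {set I} -> {set {set 'I_n}}) : set joint_point :=
  \bigcap_(U in [set U | edge_choice U S]) conv_hull (coupled U).

Definition tree_feasible : set joint_point :=
  [set x | (forall i, local_feasible (block x i)) /\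
           (forall i j, E i j -> agree_on x i j (Q i :&: Q j))].

Variable cost : forall i, local_point i.

Definition total_cost (x : joint_point) : R :=
  \sum_i \sum_(v : bag i) cost i v * block x i v.

Definition OPT : \bar R :=
  ereal_inf [set (total_cost x)%:E | x in tree_feasible].

Definition DUALM (S : {set I} -> {set {set 'I_n}}) : \bar R :=
  ereal_inf [set (total_cost x)%:E | x in relaxA S].

End TreeStructuredProblem.

Arguments relaxA R {m n I} A b binary E Q block_of S.
Arguments relaxB R {m n I} A b binary E Q block_of S.

Definition cost_splitting (R : realType) n (I : finType) (Q : I -> {set 'I_n})
    (c : 'cV[rat]_n) (cost : forall i, local_point R Q i) : Prop :=
  forall v, \sum_i \sum_(u : bag Q i | val u == v) cost i u = ratr (c v 0).

(* Main.v *)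
(* A point of [relaxA] writes each (x^(i), w^(i)) as the mean of a finite
   probability law on feasible blocks.  For T inside U_ij the moment w^(i)_T is
   the probability that all the (binary) variables of T equal 1, so, S_ij being
   down-closed, these probabilities agree at i and j for every T included in
   U_ij; by Moebius inversion the laws at i and j restrict to the same law of 0/1
   patterns on U_ij.  As the edges form a tree, the block laws can be glued, one
   leaf at a time and conditionally independently given the pattern on the new
   edge, into a joint law whose patterns agree on every edge almost surely: its
   mean is x, so x lies in the hull of the points coupled along U. *)
Require Import Defs.
From mathcomp Require Import all_boot all_order all_algebra.
From mathcomp Require Import all_classical all_reals all_analysis.

Set Implicit Arguments.
Unset Strict Implicit.
Unset Printing Implicit Defensive.

Import Order.TTheory GRing.Theory Num.Theory.

Local Open Scope classical_set_scope.
Local Open Scope ring_scope.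

(** * Growth of a tree by successive leaves *)

Lemma inducedE (I : finType) (E : rel I) (W : {set I}) (i j : I) :
  Defs.induced E W i j = [&& E i j, i \in W & j \in W].
Proof. by []. Qed.

(** Two distinct neighbours of [j] in [W], joined by a simple path inside [W], would close up
    through [j] into a cycle of at least three vertices. *)
Lemma tree_unique_neighbour (I : finType) (E : rel I) (W : {set I}) (i i' j : I) :
  is_tree E -> {in W &, forall k l, connect (Defs.induced E W) k l} ->
  i \in W -> i' \in W -> j \notin W -> E i j -> E i' j -> i' = i.
Proof.
move=> [symE _ [_ _ acyc]] conW iW i'W jW Eij Ei'j.
apply/eqP/negP => /negP neq.
have /connectP[p0 p0P ip0] := conW _ _ i'W iW.
move: ip0; case/shortenP: p0P => p pP up _ ip.
have pW : all [in W] (i' :: p).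
  rewrite /= i'W /=; elim: p (i') pP {up ip neq i'W} => //= k p IH l.
  by case/andP=> /and3P[_ _ ->] /IH.
have jp : j \notin i' :: p.
  by apply: contra jW => /(allP pW).
have := acyc (j :: i' :: p).
rewrite /ucycle /=.
case: p => [|k p] in pP up ip pW jp *; first by rewrite ip /= eqxx in neq.
move=> H; suff: (size [:: j, i', k & p] <= 2)%N by [].
apply: H; apply/andP; split; last by rewrite cons_uniq jp.
have {}pP : path (Defs.induced E [set: I]) i' (k :: p).
  by apply: (sub_path _ pP) => a c /and3P[Eac _ _]; rewrite inducedE Eac !finset.in_setT.
move: pP => /= /andP[-> pP].
by rewrite rcons_path pP -[last k p]/(last i' (k :: p)) -ip !inducedE !finset.in_setT symE Ei'j Eij.
Qed.

Lemma tree_grow_ind (I : finType) (E : rel I) (P : {set I} -> Prop) :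
  is_tree E -> (forall i, P [set i]%SET) ->
  (forall (W : {set I}) i j, P W -> i \in W -> j \notin W -> E i j ->
     (forall i', i' \in W -> E i' j -> i' = i) -> P (j |: W)%SET) ->
  P [set: I]%SET.
Proof.
move=> tE P1 PS; have [symE _ [/finset.set0Pn[r _] conT _]] := tE.
(* The induction also carries connectedness of [W], without which [tree_unique_neighbour] could not
   supply the uniqueness asked for by the inductive premise. *)
have {P1} : exists W : {set I}, [/\ r \in W, P W &
    {in W &, forall k l, connect (Defs.induced E W) k l}].
  exists [set r]%SET; split; rewrite ?set11 // => k l.
  by rewrite !inE => /eqP -> /eqP ->; apply: connect0.
case=> W; have [m] := ubnP #|~: W|%SET.
elim: m W => // m IH W; rewrite ltnS => leW [rW PW conW].
have [/eqP <- //|WT] := boolP (W == [set: I])%SET.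
have [x [y [xW yW Exy]]] : exists x y, [/\ x \in W, y \notin W & E x y].
  have [] := boolP [exists x in W, [exists y in ~: W, E x y]]%SET.
    by case/exists_inP=> x xW /exists_inP[y]; rewrite inE => ? ?; exists x, y.
  rewrite negb_exists_in => /forall_inP cl.
  case/negP: WT; apply/eqP/finset.setP => z; rewrite finset.in_setT.
  have symT : symmetric (Defs.induced E [set: I]).
    by move=> a c; rewrite !inducedE !finset.in_setT !andbT symE.
  (* If no edge left [W], it would be a union of components of a connected graph and, containing
     [r], would be everything. *)
  rewrite -(@closed_connect _ (Defs.induced E [set: I]) (mem W) _ r z) ?conT ?rW ?finset.in_setT //.
  apply: (intro_closed (sym_connect_sym symT)) => a c.
  move=> /and3P[Eac _ _] aW; have := cl _ aW.
    by rewrite negb_exists_in => /forall_inP/(_ c); rewrite inE Eac; case: (c \in W) => // /(_ isT).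
have subW : subrel (Defs.induced E W) (Defs.induced E (y |: W)%SET).
  by move=> a c /and3P[e aW cW]; rewrite inducedE e !inE aW cW !orbT.
apply: (IH (y |: W)%SET).
  apply: leq_trans leW; apply: proper_card.
  rewrite properE finset.setCS finset.subsetUr /=; apply/subsetPn; exists y; rewrite !inE ?eqxx //.
have sconn a c : a \in W -> c \in W -> connect (Defs.induced E (y |: W)%SET) a c.
  move=> aW cW; apply: (connect_sub _ (conW _ _ aW cW)) => u v uv.
  exact/connect1/subW.
have xy : connect (Defs.induced E (y |: W)%SET) x y.
  by apply: connect1; rewrite inducedE Exy !inE xW eqxx orbT.
have yx : connect (Defs.induced E (y |: W)%SET) y x.
  by apply: connect1; rewrite inducedE symE Exy !inE xW eqxx orbT.
split.
- by rewrite !inE rW orbT.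
- apply: (PS W x y) => // x' x'W Ex'y.
  exact: (tree_unique_neighbour tE conW xW x'W yW).
- move=> a c; rewrite !inE => /predU1P[->|aW] /predU1P[->|cW] //.
  + exact: (connect_trans yx (sconn _ _ _ _)).
  + exact: (connect_trans (sconn _ _ _ _) xy).
  + exact: sconn.
Qed.

(** * Gluing of finite laws along a tree *)

(** Here [pat i j l] is what outcome [l] of block [i] shows on the edge towards [j]. Marginals are
    tested against arbitrary [g], so that indicators, constants and coordinates are all covered. *)
Lemma tree_coupling (R : realFieldType) (I : finType) (E : rel I)
    (J : I -> finType) (P : eqType) (q : forall i, J i -> R)
    (pat : forall i, I -> J i -> P) :
  is_tree E -> (forall i l, 0 <= q i l) -> (forall i, \sum_l q i l = 1) ->
  (forall i j, E i j -> forall z,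
     \sum_(l | pat i j l == z) q i l = \sum_(l | pat j i l == z) q j l) ->
  exists (K : finType) (p : K -> R) (f : K -> forall i, J i),
    [/\ forall k, 0 <= p k,
        forall i (g : J i -> R), \sum_k p k * g (f k i) = \sum_l q i l * g l
      & forall k i j, E i j -> p k != 0 -> pat i j (f k i) = pat j i (f k j)].
Proof.
move=> tE q0 q1 qE; have [symE irrE _] := tE.
(* Total mass 1 forces an outcome to exist; it serves as a filler for the blocks that the induction
   has not reached. *)
have inhJ i : exists l : J i, true.
  have [l _|J0] := pickP (predT : pred (J i)); first by exists l.
  have := q1 i; rewrite big_pred0 // => /eqP.
  by rewrite eq_sym oner_eq0.
pose d i : J i := xchoose (inhJ i).
pose coupled_on (W : {set I}) :=
  exists (K : finType) (p : K -> R) (f : K -> forall i, J i),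
    [/\ forall k, 0 <= p k,
        forall i, i \in W -> forall g : J i -> R,
          \sum_k p k * g (f k i) = \sum_l q i l * g l
      & forall k i j, i \in W -> j \in W -> E i j ->
          p k != 0 -> pat i j (f k i) = pat j i (f k j)].
suff [K [p [f [p0 pm pe]]]] : coupled_on [set: I]%SET.
  exists K, p, f; split=> // [i g|k i j Eij pk]; first by rewrite pm // finset.in_setT.
  by apply: pe; rewrite ?finset.in_setT.
apply: (tree_grow_ind tE) => [r|W i j [K [p [f [p0 pm pe]]]] iW jW Eij uniqi].
  exists (J r), (q r), (fun l : J r => eqtype.dfwith d l); split=> [//|i|k i j].
    by rewrite inE => /eqP -> g; under eq_bigr do rewrite dfwith_in.
  by rewrite !inE => /eqP-> /eqP->; rewrite irrE.
have neqW i' : i' \in W -> j != i' by apply: contraTneq => <-.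
pose nu z := \sum_(l | pat j i l == z) q j l.
(* The pattern law [nu] of the new edge is the same seen from [j] and from the glued blocks: [qE]
   crosses the edge, then the marginal at [i] is tested on an indicator. *)
have nuE z : nu z = \sum_(k | pat i j (f k i) == z) p k.
  have indic (x : R) b : (if b then x else 0) = x * b%:R by rewrite mulr_natr mulrb.
  rewrite /nu -(qE _ _ Eij) big_mkcond [RHS]big_mkcond.
  under eq_bigr do rewrite indic.
  under [RHS]eq_bigr do rewrite indic.
  exact/esym/(pm i iW (fun l => (pat i j l == z)%:R)).
(* An outcome of nonzero weight has a pattern with nonzero [nu], so the division in [p'] degenerates
   only where its numerator vanishes. *)
have nuJ l : q j l != 0 -> nu (pat j i l) != 0.
  move=> ql; rewrite psumr_neq0 // (introT hasP) //; exists l; rewrite ?mem_index_enum //.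
  by rewrite eqxx lt_def ql q0.
have nuK k : p k != 0 -> nu (pat i j (f k i)) != 0.
  move=> pk; rewrite nuE psumr_neq0 // (introT hasP) //; exists k; rewrite ?mem_index_enum //.
  by rewrite eqxx lt_def pk p0.
have nu0 z : 0 <= nu z by apply: sumr_ge0.
(* The new block j is drawn independently of the blocks of W given its pattern. *)
pose p' (kl : K * J j) := if pat j i kl.2 == pat i j (f kl.1 i)
  then p kl.1 * q j kl.2 / nu (pat j i kl.2) else 0.
have p'0 kl : 0 <= p' kl.
  by rewrite /p'; case: ifP => // _; rewrite divr_ge0 // mulr_ge0.
have p'1 k : \sum_l p' (k, l) = p k.
  rewrite /p' /= -big_mkcond /=.
  rewrite (eq_bigr (fun l => p k / nu (pat i j (f k i)) * q j l)); last first.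
    by move=> l /eqP ->; rewrite mulrAC.
  rewrite -mulr_sumr -/(nu _).
  have [->|pk] := eqVneq (p k) 0; first by rewrite !mul0r.
  by rewrite divfK // nuK.
have p'2 l : \sum_k p' (k, l) = q j l.
  rewrite /p' /= -big_mkcond /= -mulr_suml -mulr_suml.
  under eq_bigl do rewrite eq_sym.
  rewrite -nuE mulrAC.
  have [->|ql] := eqVneq (q j l) 0; first by rewrite mulr0.
  by rewrite divff ?mul1r // nuJ.
exists (K * J j)%type, p', (fun kl : K * J j => eqtype.dfwith (f kl.1) kl.2); split=> //.
- move=> a; rewrite !inE => /predU1P[->|aW] g.
    under eq_bigr do rewrite dfwith_in.
    rewrite -(pair_bigA _ (fun k l => p' (k, l) * g l)) exchange_big /=.
    by apply: eq_bigr => l _; rewrite -mulr_suml p'2.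
  under eq_bigr do rewrite dfwith_out ?neqW //.
  rewrite -(pair_bigA _ (fun k l => p' (k, l) * g (f k a))) /= -(pm _ aW).
  by apply: eq_bigr => k _; rewrite -mulr_suml p'1.
(* An edge at [j] can only lead to [i], where the definition of [p'] enforces agreement; the other
   edges were settled before. *)
- have edge kl : p' kl != 0 -> pat j i kl.2 = pat i j (f kl.1 i).
    by rewrite /p'; case: (pat j i kl.2 =P _) => // _; rewrite eqxx.
  have ppos kl : p' kl != 0 -> p kl.1 != 0.
    by rewrite /p'; case: ifP; rewrite ?eqxx // !mulf_eq0 !negb_or => _ /andP[/andP[]].
  move=> kl a c; rewrite !inE => /predU1P[->|aW] /predU1P[->|cW].
  + by rewrite irrE.
  + rewrite symE => Ecj /edge e; move: e; rewrite (uniqi _ cW Ecj).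
    by rewrite dfwith_in dfwith_out ?neqW.
  + move=> Eaj /edge e; move: e; rewrite (uniqi _ aW Eaj).
    by rewrite dfwith_in dfwith_out ?neqW.
  + by move=> Eac /ppos pk; rewrite !dfwith_out ?neqW //; apply: pe.
Qed.

(** * Inversion over the lattice of subsets *)

(** Moebius inversion without signs: the sum over supersets of [Z] is the term at [Z] plus terms at
    strict supersets, which agree by induction on the size of the complement and cancel. *)
Lemma law_of_superset_sums (R : zmodType) (V K L : finType) (p : K -> R)
    (q : L -> R) (X : K -> {set V}) (Y : L -> {set V}) :
  (forall T : {set V},
     \sum_(k | T \subset X k) p k = \sum_(l | T \subset Y l) q l) ->
  forall Z : {set V}, \sum_(k | X k == Z) p k = \sum_(l | Y l == Z) q l.
Proof.
move=> H Z; have [m] := ubnP #|~: Z|%SET.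
elim: m Z => // m IH Z; rewrite ltnS => leZ.
have split_sum (M : finType) (r : M -> R) (F : M -> {set V}) :
    \sum_(k | Z \subset F k) r k = \sum_(k | F k == Z) r k +
      \sum_(T : {set V} | Z \proper T) \sum_(k | F k == T) r k.
  rewrite (partition_big F (fun T => Z \subset T)) //= (bigD1 Z) //=.
  congr (_ + _).
    by apply: eq_bigl => k; case: eqP => [->|]; rewrite ?subxx ?andbF.
  apply: eq_big => [T|T /andP[ZT _]]; first by rewrite finset.properEneq eq_sym andbC.
  by apply: eq_bigl => k; case: eqP => [->|]; rewrite ?ZT ?andbF.
have := H Z; rewrite !split_sum.
rewrite [X in _ + X = _](eq_bigr (fun T => \sum_(l | Y l == T) q l)); first by move/addIr.
move=> T ZT; apply: IH; apply: leq_trans leZ; apply: proper_card.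
by move: ZT; rewrite !properE !finset.setCS.
Qed.

(** * Convex hulls and finite means *)

Lemma conv_hull_mixture (R : realType) (M : lmodType R) (X : set M) (x : M) :
  conv_hull X x -> exists (K : finType) (q : K -> R) (y : K -> M),
    [/\ forall k, 0 <= q k, \sum_k q k = 1, forall k, X (y k)
      & x = \sum_k q k *: y k].
Proof.
apply: (@smallest_sub _ _ _ [set x | exists (K : finType) (q : K -> R) (y : K -> M),
    [/\ forall k, 0 <= q k, \sum_k q k = 1, forall k, X (y k)
      & x = \sum_k q k *: y k]]) => [|z Xz].
  move=> u v t; rewrite !inE => -[K [q [y [q0 q1 yX ->]]]] [L [r [z [r0 r1 zX ->]]]].
  (* A convex combination of two means is a mean over the disjoint union of their index types. *)
  exists (K + L)%type, (fun s => match s with inl k => t%:num * q k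
    | inr l => (1 - t%:num) * r l end),
    (fun s => match s with inl k => y k | inr l => z l end); split.
  - by move=> [k|l]; rewrite mulr_ge0 // subr_ge0.
  - by rewrite big_sumType /= -!mulr_sumr q1 r1 !mulr1 subrKC.
  - by case.
  - rewrite big_sumType /= /conv /=.
    by congr (_ + _); rewrite scaler_sumr; apply: eq_bigr => k _; rewrite scalerA.
by exists unit, (fun=> 1), (fun=> z); split; rewrite ?big_const ?card_unit /= ?addr0 ?scale1r.
Qed.

(** Points of zero weight are left unconstrained because the glued patterns agree only almost
    surely. *)
Lemma conv_hull_sum (R : realType) (M : lmodType R) (X : set M) (K : finType)
    (q : K -> R) (y : K -> M) :
  (forall k, 0 <= q k) -> \sum_k q k = 1 -> (forall k, q k != 0 -> X (y k)) ->
  conv_hull X (\sum_k q k *: y k).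
Proof.
move=> q0 q1 yX C [Ccvx XC].
(* Partial sums are normalised to stay in [C]; adding a point is then one binary convex combination,
   with weight [q k / (q k + a)] on the new point. *)
suff H s : 0 < \sum_(k <- s) q k ->
    C ((\sum_(k <- s) q k)^-1 *: \sum_(k <- s) q k *: y k).
  by have := H (index_enum K); rewrite q1 ltr01 invr1 scale1r; apply.
elim: s => [|k s IH]; rewrite ?big_nil ?ltxx // !big_cons.
have [->|qk] := eqVneq (q k) 0; first by rewrite add0r scale0r add0r.
have kpos : 0 < q k by rewrite lt_def qk q0.
have Ck := XC _ (yX _ qk).
have : 0 <= \sum_(l <- s) q l by apply: sumr_ge0.
rewrite le_eqVlt => /predU1P[s0 _|spos _].
  have -> : \sum_(l <- s) q l *: y l = 0.
    rewrite big_seq big1 // => l ls; move/esym/eqP: s0.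
    by rewrite psumr_eq0 // => /allP/(_ _ ls)/eqP ->; rewrite scale0r.
  by rewrite -s0 !addr0 scalerA mulVf // scale1r.
move: (\sum_(l <- s) q l) (\sum_(l <- s) q l *: y l) spos (IH spos) => a v a0 Cv.
have qa0 : 0 < q k + a by rewrite addr_gt0.
have t0 : 0 <= q k / (q k + a) by rewrite divr_ge0 ?ltW.
have t1 : q k / (q k + a) <= 1 by rewrite ler_pdivrMr // mul1r lerDl ltW.
have := Ccvx (y k) (a^-1 *: v) (Itv01 t0 t1).
rewrite !inE => /(_ Ck Cv); rewrite /conv /=.
have apos : q k + a != 0 by rewrite gt_eqF.
congr C; rewrite scalerDr !scalerA; congr (_ *: _ + _ *: _); first by rewrite mulrC.
transitivity ((1 - q k / (q k + a)) / a) => //.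
by rewrite -[X in X - _](divff apos) -mulrBl addrAC subrr add0r mulrAC divff ?gt_eqF // mul1r.
Qed.

(** * Patterns, moments and the relaxations *)

Section Relaxations.
Variables (R : realType) (m n : nat) (I : finType).
Variables (A : 'M[rat]_(m, n)) (b : 'cV[rat]_m) (binary : {set 'I_n}).
Variables (E : rel I) (Q : I -> {set 'I_n}) (block_of : 'I_m -> I).

(** This encodes the 0/1 pattern of [y] on [U], as a set of global variables so that patterns from
    different blocks are comparable. *)
Definition ones i (U : {set 'I_n}) (y : local_point R Q i) : {set 'I_n} :=
  [set v in U | [exists u : bag Q i, (val u == v) && (y u == 1)]].

Lemma in_onesE i (U : {set 'I_n}) (y : local_point R Q i) (u : bag Q i) :
  (val u \in ones U y) = (val u \in U) && (y u == 1).
Proof.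
rewrite inE; congr (_ && _); apply/existsP/idP => [[u']|yu].
  by case/andP=> /eqP/val_inj ->.
by exists u; rewrite eqxx.
Qed.

(** Averaging this indicator turns a moment into a superset sum, the form that
    [law_of_superset_sums] inverts. *)
Lemma prod_binary i (T U : {set 'I_n}) (y : local_point R Q i) :
  T \subset U -> T \subset Q i ->
  (forall u : bag Q i, val u \in T -> y u = 0 \/ y u = 1) ->
  \prod_(u : bag Q i | val u \in T) y u = (T \subset ones U y)%:R.
Proof.
move=> TU TQ y01; have [sub|] := boolP (T \subset ones U y).
  rewrite big1 // => u uT; have := fintype.subsetP sub _ uT.
  by rewrite in_onesE => /andP[_ /eqP].
case/fintype.subsetPn => v vT; have vQ := fintype.subsetP TQ _ vT.
have vU := fintype.subsetP TU _ vT.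
rewrite -[v]/(val (Sub v vQ : bag Q i)) in_onesE /= vU /= => yv.
rewrite (bigD1 (Sub v vQ)) //=.
by case: (y01 (Sub v vQ) vT) yv => ->; rewrite ?eqxx // mul0r.
Qed.

Hypothesis tE : is_tree E.
Hypothesis hbin : forall i j : I, E i j -> Q i :&: Q j \subset binary.

(** A single [U] is fixed: letting it vary gives the inclusion in [relaxB], and taking the whole bag
    intersections gives duality. *)
Lemma relaxA_sub_conv_coupled (S : {set I} -> {set {set 'I_n}}) U :
  (forall i j, E i j -> S [set i; j]%SET \subset powerset (Q i :&: Q j)) ->
  (forall i j, E i j -> down_closed (S [set i; j]%SET)) ->
  edge_choice E U S ->
  relaxA R A b binary E Q block_of S `<=` conv_hull (coupled A b binary E block_of U).
Proof.
move=> hS dS US x [w [xw ww]].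
have [symE _ _] := tE.
have UQ i j : E i j -> U [set i; j]%SET \subset Q i.
  move=> Eij; have := fintype.subsetP (hS _ _ Eij) _ (US _ _ Eij).
  by rewrite inE finset.subsetI => /andP[].
have Ubin i j : E i j -> U [set i; j]%SET \subset binary.
  move=> Eij; have := fintype.subsetP (hS _ _ Eij) _ (US _ _ Eij).
  by rewrite inE => /fintype.subset_trans; apply; apply: hbin.
pose mixture i (K : finType) (q : K -> R) (y : K -> local_point R Q i * moments R Q i) :=
  [/\ forall k, 0 <= q k, \sum_k q k = 1,
      forall k, moment_feasible A b binary block_of (y k)
    & (block x i, w i) = \sum_k q k *: y k].
have H i : exists (K : finType) (q : K -> R) y, mixture i K q y.
  exact: conv_hull_mixture (xw i).
(* Choice over all blocks goes in three rounds, since weights and points have types depending on the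
   index types. *)
have [J {}H] : exists J : I -> finType, forall i, exists (q : J i -> R) y, mixture i (J i) q y.
  by exists (fun i => projT1 (cid (H i))) => i; apply: projT2 (cid (H i)).
have [q {}H] : exists q : forall i, J i -> R, forall i, exists y, mixture i (J i) (q i) y.
  by exists (fun i => projT1 (cid (H i))) => i; apply: projT2 (cid (H i)).
have [y {}H] : exists y : forall i, J i -> local_point R Q i * moments R Q i,
    forall i, mixture i (J i) (q i) (y i).
  by exists (fun i => projT1 (cid (H i))) => i; apply: projT2 (cid (H i)).
have q0 i : forall l, 0 <= q i l by have [] := H i.
have q1 i : \sum_l q i l = 1 by have [] := H i.
have yX i : forall l, moment_feasible A b binary block_of (y i l) by have [] := H i.
have xE i : (block x i, w i) = \sum_l q i l *: y i l by have [] := H i.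
have y01 i l (u : bag Q i) : val u \in binary -> (y i l).1 u = 0 \/ (y i l).1 u = 1.
  by have [[_ bin] _] := yX i l; apply: bin.
have blockE i u : block x i u = \sum_l q i l * (y i l).1 u.
  have /(congr1 fst) /= -> := xE i.
  rewrite (big_morph fst (id1 := 0) (op1 := +%R)) //.
  by rewrite sum_ffunE; apply: eq_bigr => l _; rewrite ffunE.
have wE i T : w i T = \sum_l q i l * (y i l).2 T.
  have /(congr1 snd) /= -> := xE i.
  rewrite (big_morph snd (id1 := 0) (op1 := +%R)) //.
  by rewrite sum_ffunE; apply: eq_bigr => l _; rewrite ffunE.
pose pat i j (l : J i) := ones (U [set i; j]%SET) (y i l).1.
have patU i j l : pat i j l \subset U [set i; j]%SET.
  by apply/fintype.subsetP => v; rewrite inE => /andP[].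
have momentE i j (T : {set 'I_n}) (TQ : T \subset Q i) : E i j -> T \subset U [set i; j]%SET ->
    w i (Sub T TQ) = \sum_(l | T \subset pat i j l) q i l.
  move=> Eij TU; rewrite wE [RHS]big_mkcond; apply: eq_bigr => l _.
  have [_ ->] := yX i l; rewrite /= (prod_binary TU TQ) ?mulr_natr ?mulrb // => u uT.
  by apply: y01; apply: (fintype.subsetP (Ubin _ _ Eij)); apply: (fintype.subsetP TU).
have patE i j : E i j -> forall z,
    \sum_(l | pat i j l == z) q i l = \sum_(l | pat j i l == z) q j l.
  move=> Eij; apply: law_of_superset_sums => T.
  have Eji : E j i by rewrite symE.
  (* Patterns lie in [U], so both sums are empty unless [T] does too; in that case down-closedness
     puts [T] among the dualized sets. *)
  have [TU|TU] := boolP (T \subset U [set i; j]%SET); last first.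
    rewrite !big_pred0 // => l; apply: contraNF TU => /fintype.subset_trans; apply=> //.
    by rewrite finset.setUC.
  have TU' : T \subset U [set j; i]%SET by rewrite finset.setUC.
  have Ti := fintype.subset_trans TU (UQ _ _ Eij).
  have Tj := fintype.subset_trans TU' (UQ _ _ Eji).
  rewrite -(momentE _ _ _ Ti) // -(momentE _ _ _ Tj) //.
  by apply: ww => //; apply: dS (US _ _ Eij) TU.
have [K [p [f [p0 pm pe]]]] := tree_coupling tE q0 q1 patE.
pose X k : joint_point R Q :=
  [ffun t => (y (tag t) (f k (tag t))).1 (tagged t)].
have blockX k i : block (X k) i = (y i (f k i)).1.
  by apply/ffunP => u; rewrite !ffunE.
(* A tree has a vertex, and the marginal there, tested on the constant 1, gives the total mass. *)
have [_ _ [/finset.set0Pn[r _] _ _]] := tE.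
have p1 : \sum_k p k = 1.
  have := pm r (fun=> 1); rewrite (eq_bigr p) => [->|k _]; last by rewrite mulr1.
  by under eq_bigr do rewrite mulr1.
have -> : x = \sum_k p k *: X k.
  apply/ffunP => -[i u]; rewrite sum_ffunE.
  under eq_bigr do rewrite !ffunE /=.
  by rewrite (pm i (fun l => (y i l).1 u)) -blockE ffunE.
apply: conv_hull_sum => // k pk; split=> [i|i j Eij v vi vj vU].
  by rewrite blockX; case: (yX i (f k i)).
have Eji : E j i by rewrite symE.
rewrite !blockX.
have vbin : v \in binary by apply: (fintype.subsetP (Ubin _ _ Eij)).
(* Equal patterns say that the two copies of [v] equal 1 simultaneously; being binary, they are
   equal. *)
have := congr1 (fun Z : {set 'I_n} => v \in Z) (pe k i j Eij pk).
rewrite -{1}[v]/(val (Sub v vi : bag Q i)) -{2}[v]/(val (Sub v vj : bag Q j)).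
rewrite !in_onesE /= [X in _ = (_ \in U X) && _]finset.setUC vU /=.
case: (y01 i (f k i) (Sub v vi) vbin) => ->;
  case: (y01 j (f k j) (Sub v vj) vbin) => ->; rewrite // !eqxx ?oner_eq0 //.
all: by rewrite eq_sym oner_eq0.
Qed.

Lemma tree_feasible_sub_relaxA (S : {set I} -> {set {set 'I_n}}) :
  (forall i j, E i j -> S [set i; j]%SET \subset powerset (Q i :&: Q j)) ->
  tree_feasible A b binary E block_of `<=` relaxA R A b binary E Q block_of S.
Proof.
move=> hS x [xX xc].
exists (fun i => [ffun T : subbag Q i =>
  \prod_(v : bag Q i | val v \in val T) block x i v]); split.
  by move=> i; apply: sub_gen_smallest; split=> //= T; rewrite ffunE.
move=> i j Eij T Ti Tj TS; rewrite !ffunE /=.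
(* The products at [i] and [j] run over different bag types; both are moved to global variables,
   where the default 0 is never met since [T] lies in the bag. *)
have prodE k (Tk : T \subset Q k) : \prod_(v : bag Q k | val v \in T) block x k v =
    \prod_(v in T) (if insub v is Some u then block x k u else 0).
  pose g v : R := if insub v is Some u then block x k u else 0.
  rewrite -[RHS]/(\prod_(v in T) g v).
  rewrite (eq_bigr (fun v => g (val v))) => [|u _]; last by rewrite /g valK.
  rewrite [RHS](reindex_omap (val : bag Q k -> 'I_n) insub) => [|v vT]; last first.
    by rewrite insubT ?(fintype.subsetP Tk) // => vk /=.
  by apply: eq_bigl => u; rewrite valK eqxx andbT.
rewrite !prodE //; apply: eq_bigr => v vT.
have vi := fintype.subsetP Ti _ vT; have vj := fintype.subsetP Tj _ vT.
by rewrite !insubT; apply: xc => //; rewrite inE vi.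
Qed.

End Relaxations.

(** * Costs on hulls and strong duality *)

(** The cost is linear, so its superlevel sets are convex. The bound is an extended real because it
    will be [OPT], possibly infinite. *)
Lemma total_cost_conv_hull (R : realType) (n : nat) (I : finType)
    (Q : I -> {set 'I_n}) (cost : forall i, local_point R Q i)
    (X : set (joint_point R Q)) (r : \bar R) :
  (forall x, X x -> (r <= (total_cost cost x)%:E)%E) ->
  forall x, conv_hull X x -> (r <= (total_cost cost x)%:E)%E.
Proof.
move=> rX; apply: smallest_sub => // x z t; rewrite !inE /=.
have -> : total_cost cost (conv t (x : convex_lmodType _) z) =
    t%:num * total_cost cost x + (1 - t%:num) * total_cost cost z.
  rewrite /total_cost !mulr_sumr -big_split; apply: eq_bigr => i _ /=.
  rewrite !mulr_sumr -big_split; apply: eq_bigr => u _ /=.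
  by rewrite !ffunE mulrDr mulrCA; congr (_ + _); rewrite mulrCA.
case: r {rX} => [r| |]; rewrite ?leNye ?leye_eq ?lee_fin // => rx rz.
rewrite -[r]mul1r -{1}(subrKC t%:num 1) mulrDl.
by apply: lerD; apply: ler_wpM2l => //; rewrite subr_ge0.
Qed.

Theorem theorem8 (R : realType) (m n : nat) (I : finType)
  (A : 'M[rat]_(m, n)) (b : 'cV[rat]_m) (c : 'cV[rat]_n) (binary : {set 'I_n})
  (E : rel I) (Q : I -> {set 'I_n}) (block_of : 'I_m -> I)
  (cost : forall i : I, local_point R Q i) (S : {set I} -> {set {set 'I_n}})
  (hQ : tree_decomposition (intersection_graph A) E Q)
  (hassign : assignment A Q block_of)
  (hcost : cost_splitting c cost)
  (hbin : forall i j : I, E i j -> Q i :&: Q j \subset binary)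
  (hS : forall i j : I, E i j -> S [set i; j]%SET \subset powerset (Q i :&: Q j)) :
  ((forall i j : I, E i j -> down_closed (S [set i; j]%SET)) ->
     relaxA R A b binary E Q block_of S `<=` relaxB R A b binary E Q block_of S) /\
  ((forall i j : I, E i j -> S [set i; j]%SET = powerset (Q i :&: Q j)) ->
     DUALM A b binary E block_of cost S = OPT A b binary E block_of cost).
Proof.
have [tE _ _ _] := hQ; split=> [dS x xA U US|Sfull].
  exact: (relaxA_sub_conv_coupled tE hbin hS dS US).
(* Intersecting the bags over the members of [e] makes the bag intersection a function of the
   unordered edge. *)
pose U (e : {set I}) : {set 'I_n} := (\bigcap_(i in e) Q i)%SET.
have UE i j : E i j -> U [set i; j]%SET = (Q i :&: Q j)%SET.
  move=> Eij; rewrite /U finset.bigcap_setU !finset.big_set1 //.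
have dS i j : E i j -> down_closed (S [set i; j]%SET).
  by move=> Eij X Y; rewrite Sfull // !inE => XQ /fintype.subset_trans; apply.
have US : edge_choice E U S by move=> i j Eij; rewrite UE // Sfull // inE.
apply/eqP; rewrite eq_le; apply/andP; split.
  by apply: ereal_inf_le_tmp => _ [x xF <-]; exists x => //; apply: tree_feasible_sub_relaxA.
(* For the other inequality, each point of [relaxA] lies in the hull of the points coupled along
   this [U], which are exactly tree-feasible. *)
apply: le_ereal_inf_tmp => _ [x /(relaxA_sub_conv_coupled tE hbin hS dS US) xU <-].
apply: total_cost_conv_hull xU => z [zX zc]; apply: ereal_inf_lbound.
by exists z => //; split=> // i j Eij; rewrite -UE //; apply: zc.
Qed.
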